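(* Let $\mathbf L$ be an atomless Borel mapping such that for every measurable subset $X$ of $Z(\mathbf L)$ it holds $\nu_{\mathbf L}(f_{\mathbf L}(X))=\nu_{\mathbf L}(X)$. Then there exists a ${\rm QF}$-convergent sequence $(\mathbf F_n)_{n\in\mathbb N}$ of finite mappings such that $\mathbf L$ is its ${\rm QF}$-limit, i.e. $\langle\phi,\mathbf L\rangle=\lim_{n\to\infty}\langle\phi,\mathbf F_n\rangle$ for every quantifier-free formula $\phi$.
   Context: A (colored) mapping is a structure $\mathbf F$ in a signature consisting of one unary function symbol $f$ and finitely many unary relation symbols; its domain is $F$ and $f_{\mathbf F}:F\to F$ interprets $f$. For a formula $\phi$ with $p$ free variables, $\phi(\mathbf F)=\{(v_1,\dots,v_p)\in F^p:\mathbf F\models\phi(v_1,\dots,v_p)\}$; for finite $\mathbf F$, $\langle\phi,\mathbf F\rangle=|\phi(\mathbf F)|/|F|^p$. A Borel mapping is a mapping whose domain $F$ is a standard Borel space equipped with a Borel probability measure $\nu_{\mathbf F}$, with $f_{\mathbf F}$ and the color classes Borel; for quantifier-free $\phi$, $\langle\phi,\mathbf F\rangle=\nu_{\mathbf F}^{\otimes p}(\phi(\mathbf F))$. It is atomless if $\nu_{\mathbf F}(\{v\})=0$ for all $v\in F$. A sequence of finite mappings is ${\rm QF}$-convergent if $\lim_n\langle\phi,\mathbf F_n\rangle$ exists for every quantifier-free formula $\phi$. An element $x$ is cyclic if $f_{\mathbf F}^k(x)=x$ for some $k\ge 1$; $Z(\mathbf F)$ denotes the set of cyclic elements. *)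

(* Defs.v *)
From HB Require Import structures.
From mathcomp Require Import all_boot all_order all_algebra.
From mathcomp Require Import all_classical all_reals all_analysis.

Set Implicit Arguments.
Unset Strict Implicit.
Unset Printing Implicit Defensive.

Import Order.TTheory GRing.Theory Num.Theory.
Import numFieldNormedType.Exports.

Local Open Scope classical_set_scope.
Local Open Scope ring_scope.

(* [C] is the finite set of unary relation symbols (colors) of the signature. *)
Record mapping (C : finType) (F : Type) := Mapping {
  mp_fun : F -> F ;
  mp_color : C -> set F }.

Inductive qf_term (p : nat) : Type :=
| Var of 'I_p
| App of qf_term p.

(* Quantifier-free formulas whose free variables are among x_0, ..., x_(p-1). *)
Inductive qf_formula (C : finType) (p : nat) : Type :=
| QFalse
| QEq of qf_term p & qf_term p
| QColor of C & qf_term p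
| QNot of qf_formula C p
| QAnd of qf_formula C p & qf_formula C p
| QOr of qf_formula C p & qf_formula C p.

Fixpoint qf_eval (C : finType) (F : Type) (M : mapping C F) (p : nat)
    (v : 'I_p -> F) (t : qf_term p) : F :=
  match t with
  | Var i => v i
  | App t' => mp_fun M (qf_eval M v t')
  end.

Fixpoint qf_sat (C : finType) (F : Type) (M : mapping C F) (p : nat)
    (v : 'I_p -> F) (phi : qf_formula C p) : Prop :=
  match phi with
  | QFalse => False
  | QEq t u => qf_eval M v t = qf_eval M v u
  | QColor c t => mp_color M c (qf_eval M v t)
  | QNot psi => ~ qf_sat M v psi
  | QAnd psi chi => qf_sat M v psi /\ qf_sat M v chi
  | QOr psi chi => qf_sat M v psi \/ qf_sat M v chi
  end.

Definition solutions (C : finType) (F : Type) (M : mapping C F) (p : nat)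
    (phi : qf_formula C p) : set (p.-tuple F) :=
  [set v | qf_sat M (tnth v) phi].

Definition cyclic_elements (C : finType) (F : Type) (M : mapping C F) :
    set F :=
  [set x | exists2 k : nat, (0 < k)%N & iter k (mp_fun M) x = x].

Record finite_mapping (C : finType) := FiniteMapping {
  fm_dom : finType ;
  fm_dom_gt0 : (0 < #|fm_dom|)%N ;
  fm_map :> mapping C fm_dom }.

Definition finite_density (R : realType) (C : finType) (p : nat)
    (phi : qf_formula C p) (F : finite_mapping C) : R :=
  #|[pred v : p.-tuple (fm_dom F) | v \in solutions F phi]|%:R
    / #|fm_dom F|%:R ^+ p.

Definition polish (R : realType) (X : metricType R) : Prop :=
  (forall G : set_system X, ProperFilter G -> cauchy G ->
     exists x : X, G --> x) /\
  (exists2 D : set X, countable D & dense D).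

(* The sigma-algebra of [T] is that of the Borel sets of a Polish space,
   transported along a bijection. *)
Definition standard_borel (R : realType) (d : measure_display)
    (T : measurableType d) : Prop :=
  exists (X : metricType R) (g : T -> X),
    [/\ polish X, bijective g &
        forall A : set T,
          measurable A <-> <<s [set U : set X | open U] >> (g @` A)].

Fixpoint power_measure (R : realType) (d : measure_display)
    (T : measurableType d) (nu : set T -> \bar R) (p : nat) :
    set (p.-tuple T) -> \bar R :=
  match p with
  | 0 => dirac [tuple]
  | p'.+1 => pushforward (product_measure1 nu (power_measure nu (p := p')))
               (fun z : T * p'.-tuple T => [tuple of z.1 :: z.2])
  end.

Record borel_mapping (R : realType) (C : finType) := BorelMapping {
  bm_disp : measure_display ;
  bm_dom : measurableType bm_disp ;
  bm_standard : standard_borel R bm_dom ;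
  bm_prob : probability bm_dom R ;
  bm_map :> mapping C bm_dom ;
  bm_fun_measurable : measurable_fun setT (mp_fun bm_map) ;
  bm_color_measurable : forall c, measurable (mp_color bm_map c) }.

Definition atomless (R : realType) (C : finType) (L : borel_mapping R C) :
    Prop :=
  forall v : bm_dom L, bm_prob L [set v] = 0%E.

Definition borel_density (R : realType) (C : finType) (p : nat)
    (phi : qf_formula C p) (L : borel_mapping R C) : R :=
  fine (power_measure (bm_prob L) (solutions L phi)).

Definition QF_convergent (R : realType) (C : finType)
    (F : nat -> finite_mapping C) : Prop :=
  forall (p : nat) (phi : qf_formula C p),
    cvgn (fun n => finite_density R phi (F n)).

Definition QF_limit (R : realType) (C : finType)
    (F : nat -> finite_mapping C) (L : borel_mapping R C) : Prop :=
  forall (p : nat) (phi : qf_formula C p),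
    finite_density R phi (F n) @[n --> \oo] --> borel_density phi L.

(* Auxiliary to [power_measureP]: bundles a measure of total mass 1. *)
Definition prob_copy (R : realType) (d : measure_display)
    (T : measurableType d) (m : {measure set T -> \bar R})
    (mT : m setT = 1%E) : set T -> \bar R := m.

Section prob_copy.
Context (R : realType) (d : measure_display) (T : measurableType d).
Variables (m : {measure set T -> \bar R}) (mT : m setT = 1%E).

HB.instance Definition _ := Measure.on (prob_copy mT).
HB.instance Definition _ :=
  Measure_isProbability.Build _ _ _ (prob_copy mT) mT.

End prob_copy.

(* [power_measure nu] is the product measure: it is a probability on
   p-tuples and satisfies the product rule on measurable boxes. *)
Lemma power_measureP (R : realType) (d : measure_display)
    (T : measurableType d) (nu : probability T R) (p : nat) :
  exists mu : probability (p.-tuple T) R,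
    (power_measure nu (p := p) = mu :> (set _ -> _)) /\
    forall A : 'I_p -> set T, (forall i, measurable (A i)) ->
      mu [set t | forall i, A i (tnth t i)] = (\prod_(i < p) nu (A i))%E.
Proof.
elim: p => [|p [mu [muE muA]]].
  exists (dirac [tuple]); split=> // A _.
  by rewrite big_ord0 /= diracE mem_set//=; case.
pose f := fun z : T * p.-tuple T => [tuple of z.1 :: z.2].
have mf : measurable_fun setT f by exact: measurable_cons.
pose mm := measure_function_pushforward__canonical__measure_function_Measure
  (product_measure1 nu mu) mf.
have mT : mm setT = 1%E.
  by rewrite /= /pushforward preimage_setT probability_setT.
pose P : probability (p.+1.-tuple T) R := prob_copy mT.
exists P; split; first by rewrite /= /prob_copy/= muE.
move=> A mA; rewrite big_ord_recl -muA// -product_measure1E//; last first.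
  rewrite (_ : mkset _ = \bigcap_(i in setT)
     (@tnth _ T ^~ i @^-1` A (lift ord0 i))); last first.
    by apply/seteqP; split => [t tA i _|t tA i]; [exact: tA|exact: (tA i)].
  apply: fin_bigcap_measurable => // i _.
  by rewrite -[X in measurable X]setTI; exact: measurable_tnth.
rewrite /= /prob_copy /= /pushforward; congr product_measure1.
apply/seteqP; split => -[x t] /=.
  move=> xtA; split; first exact: (xtA ord0).
  by move=> i; have := xtA (lift ord0 i); rewrite tnthS.
move=> [xA tA] i; case: (unliftP ord0 i) => [j ->|->] //.
by rewrite tnthS; exact: tA.
Qed.

(* Main.v *)
Require Import Defs.
From HB Require Import structures.
From mathcomp Require Import all_boot all_order all_algebra.
From mathcomp Require Import all_classical all_reals all_analysis.
From mathcomp Require Import zify ring lra.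

(* Sample M points of L independently. A quantifier-free formula of depth at
   most r only sees the first r iterates of its arguments, so it is enough to
   put many copies of each sample, with the right forward orbit, in a finite
   mapping. The copies of an aperiodic sample may all share the same image, so
   the forward orbits cost only a negligible number of extra elements. A sample
   of period k has to lie on a cycle of length k, whose elements are all counted:
   this amounts to replacing the sample by a uniformly random point of its cycle,
   which does not change its law since f preserves the measure of cyclic
   elements. As L is atomless, almost surely no sample lies in the forward orbit
   of another one, and then tuples of copies of distinct samples satisfy in the
   finite mapping exactly the formulas that the corresponding points satisfy
   in L. A second moment bound shows that the frequency of each formula among the
   tuples of samples is close to its density in L. *)

Set Implicit Arguments.
Unset Strict Implicit.
Unset Printing Implicit Defensive.

Import Order.TTheory GRing.Theory Num.Theory.
Import numFieldNormedType.Exports.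

Local Open Scope classical_set_scope.
Local Open Scope ring_scope.

(** * Measurability of equality in standard Borel spaces *)

(** Interiors of small balls around a countable dense set separate points. Indexing by the code [m]
    under [i] makes each union hold at most one ball and also covers an empty [D]. *)
Lemma standard_borel_separating (R : realType) (d : measure_display)
    (T : measurableType d) : standard_borel R T ->
  exists U : nat -> nat -> set T, (forall m n, measurable (U m n)) /\
    forall x y, x <> y -> exists m n, U m n x /\ ~ U m n y.
Proof.
move=> [X [g [[_ [D /countable_injP[i iI] dD]] bg gm]]].
pose O m n := \bigcup_(e in [set e | D e /\ i e = m])
                 (ball e n.+1%:R^-1 : set X)°.
exists (fun m n => g @^-1` O m n); split => [m n|x y xy].
  apply/gm; rewrite image_preimage.
    by apply: sub_sigma_algebra; apply: bigcup_open => e _; exact: open_interior.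
  by have [h _ hK] := bg; apply/seteqP; split => // z _; exists (h z).
have gxy : g x <> g y by move=> /(bij_inj bg).
have d0 : 0 < mdist (g x) (g y) by rewrite mdist_gt0; exact/eqP.
have [|n] := @ltr_add_invr R 0 (mdist (g x) (g y) / 2); first by rewrite divr_gt0.
rewrite add0r ltr_pdivlMr// => nlt.
have n0 : 0 < n.+1%:R^-1 / 2 :> R by rewrite divr_gt0.
have nb : nbhs (g x) (ball (g x) (n.+1%:R^-1 / 2)) by exact: nbhsx_ballx.
have [||e [/interior_subset xe De]] := dD (ball (g x) (n.+1%:R^-1 / 2))°.
- by exists (g x).
- exact: open_interior.
(* [e] lies within half the radius of [g x], so a whole ball around [g x] fits into [ball e]. *)
have ebx : (ball e n.+1%:R^-1)° (g x).
  apply: (@filterS _ (nbhs (g x)) _ _ _ _ nb) => z xz.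
  by rewrite [X in ball _ X](splitr _); apply: ball_triangle xz; exact: ball_sym.
exists (i e), n; split.
  by exists e.
move=> [e' [De' ie'] /interior_subset ye'].
have ee' : e' = e by apply: iI; rewrite ?inE.
rewrite {e' De' ie'}ee' in ye'.
have /interior_subset := ebx; move/ball_sym/ball_triangle => /(_ _ _ ye').
by rewrite ballEmdist/= => /(lt_trans nlt); rewrite mulr_natr mulr2n ltxx.
Qed.

(** The two values differ exactly when some set of the countable separating family contains the
    first and misses the second. *)
Lemma measurable_eq_fun (R : realType) (d d' : measure_display)
    (T : measurableType d) (S : measurableType d') (h1 h2 : S -> T) :
  standard_borel R T -> measurable_fun setT h1 -> measurable_fun setT h2 ->
  measurable [set x | h1 x = h2 x].
Proof.
move=> /standard_borel_separating[U [mU sepU]] mh1 mh2.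
rewrite (_ : mkset _ = ~` \bigcup_m \bigcup_n
    (h1 @^-1` U m n `&` h2 @^-1` (~` U m n))); last first.
  apply/seteqP; split => [x /= xE [m _ [n _ []]]|x /= nx].
    by rewrite /preimage/= xE.
  apply: contrapT => /sepU[m [n [U1 U2]]]; apply: nx.
  by exists m => //; exists n.
apply: measurableC; apply: bigcupT_measurable => m.
apply: bigcupT_measurable => n; apply: measurableI.
  by rewrite -[X in measurable X]setTI; exact: mh1.
by rewrite -[X in measurable X]setTI; apply: mh2 => //; exact: measurableC.
Qed.

(** * Powers of a probability measure *)

Definition box (T : Type) (p : nat) (A : 'I_p -> set T) : set (p.-tuple T) :=
  [set t | forall i, A i (tnth t i)].

Lemma measurable_box (d : measure_display) (T : measurableType d) (p : nat)
  (A : 'I_p -> set T) : (forall i, measurable (A i)) -> measurable (box A).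
Proof.
move=> mA; rewrite (_ : box A = \bigcap_(i in setT) (@tnth _ T ^~ i @^-1` A i)).
  apply: fin_bigcap_measurable => // i _.
  by rewrite -[X in measurable X]setTI; exact: measurable_tnth.
by apply/seteqP; split => [t tA i _|t tA i]; [exact: tA|exact: (tA i)].
Qed.

(** Boxes form a pi-system, and they generate the product sigma-algebra because a preimage under one
    coordinate is a box with all other sides full. *)
Lemma box_measure_unique (R : realType) (d : measure_display)
    (T : measurableType d) (p : nat) (m1 m2 : {measure set (p.-tuple T) -> \bar R}) :
  (m1 setT < +oo)%E ->
  (forall A : 'I_p -> set T, (forall i, measurable (A i)) ->
     m1 (box A) = m2 (box A)) ->
  forall B, measurable B -> m1 B = m2 B.
Proof.
move=> m1oo m12; pose G : set (set (p.-tuple T)) :=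
  [set box A | A in [set A | forall i, measurable (A i)]].
have GT : G setT.
  by exists (fun=> setT) => //; apply/seteqP; split.
apply: (@measure_unique _ _ _ G (fun=> setT)) => //.
- apply/seteqP; split; last first.
    apply: smallest_sub; first exact: sigma_algebra_measurable.
    by move=> _ [A mA <-]; exact: measurable_box.
  apply: smallest_sub; first exact: smallest_sigma_algebra.
  rewrite -bigcup_seq; apply: bigcup_sub => i _ _ [A mA <-].
  apply: sub_sigma_algebra.
  exists (fun j => if j == i then A else setT); first by move=> j /=; case: ifP.
  apply/seteqP; split => [t /(_ i)|t [_ tA] j]; first by rewrite eqxx.
  by case: eqP => // ->.
- move=> _ _ [A mA <-] [B mB <-]; exists (fun i => A i `&` B i).
    by move=> i; exact: measurableI.
  by apply/seteqP; split=> [t tAB|t [tA tB] i] //; split => i; have [] := tAB i.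
- by rewrite bigcup_const.
- by move=> _ [A mA <-]; exact: m12.
Qed.

Section power_prob.
Context (R : realType) (d : measure_display) (T : measurableType d).
Variable nu : probability T R.

Definition power_prob (p : nat) : probability (p.-tuple T) R :=
  projT1 (cid (power_measureP nu p)).

Lemma power_probE (p : nat) :
  power_measure nu (p := p) = power_prob p :> (set _ -> _).
Proof. by rewrite /power_prob; case: cid => mu []. Qed.

Lemma power_prob_box (p : nat) (A : 'I_p -> set T) :
  (forall i, measurable (A i)) ->
  power_prob p (box A) = (\prod_(i < p) nu (A i))%E.
Proof. by rewrite /power_prob; case: cid => mu [_ muA] /=; exact: muA. Qed.

Definition measure_preserving (h : T -> T) :=
  measurable_fun setT h /\ forall A, measurable A -> nu (h @^-1` A) = nu A.

Definition select (M q : nat) (w : 'I_q -> 'I_M) (h : 'I_q -> T -> T)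
  (s : M.-tuple T) : q.-tuple T := [tuple h l (tnth s (w l)) | l < q].

Lemma measurable_select (M q : nat) (w : 'I_q -> 'I_M) (h : 'I_q -> T -> T) :
  (forall l, measurable_fun setT (h l)) -> measurable_fun setT (select w h).
Proof.
move=> mh; apply/measurable_fun_tnthP => l.
rewrite (_ : _ \o _ = h l \o (@tnth _ T ^~ (w l))).
  by apply: measurableT_comp => //; exact: measurable_tnth.
by apply/funext => s /=; rewrite tnth_mktuple.
Qed.

(** Distinct coordinates moved by measure-preserving maps are again independent with law [nu]: the
    preimage of a box is a box, with full sides at the coordinates that [w] does not reach. *)
Lemma power_prob_select (M q : nat) (w : 'I_q -> 'I_M) (h : 'I_q -> T -> T) :
  injective w -> (forall l, measure_preserving (h l)) ->
  forall B, measurable B ->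
  power_prob M (select w h @^-1` B) = power_prob q B.
Proof.
move=> wI hP; have mh l : measurable_fun setT (h l) by have [] := hP l.
have mY := measurable_select w mh.
pose mm := measure_function_pushforward__canonical__measure_function_Measure
  (power_prob M) mY.
apply: (@box_measure_unique _ _ _ _ mm (power_prob q)) => [|A mA].
  by rewrite /= /pushforward preimage_setT probability_setT ltry.
apply: etrans (esym (power_prob_box mA)); rewrite /mm/= /pushforward.
pose A' i := if [pick l | w l == i] is Some l then h l @^-1` A l else setT.
have mA' i : measurable (A' i).
  rewrite /A'; case: pickP => [l _|_]//.
  by rewrite -[X in measurable X]setTI; exact: mh.
have A'w l : A' (w l) = h l @^-1` A l.
  rewrite /A'; case: pickP => [k /eqP/wI ->//|/(_ l)]; by rewrite eqxx.
rewrite (_ : _ @^-1` _ = box A'); last first.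
  apply/seteqP; split => [s sA i|s sA l].
    rewrite /A'; case: pickP => // l /eqP <-.
    by have := sA l; rewrite tnth_mktuple.
  by have := sA (w l); rewrite A'w tnth_mktuple.
rewrite power_prob_box// (bigID (mem (codom w)))/= [X in (_ * X)%E]big1 ?mule1.
  rewrite (eq_bigl (fun i => i \in imset w (mem 'I_q))); last first.
    move=> i; by apply/codomP/imsetP => [[l ->]|[l _ ->]]; exists l.
  rewrite big_imset/=; last by move=> ? ? _ _; exact: wI.
  by apply: eq_bigr => l _; rewrite A'w; have [_ ->] := hP l.
move=> i; rewrite /A'; case: pickP => [l /eqP <-|]; first by rewrite codom_f.
by rewrite probability_setT.
Qed.

(** The push-forward of the product of the two powers along the concatenation [c] agrees with the
    power [p + q] on boxes, hence on all measurable sets. *)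
Lemma power_prob_split (p q : nat) (A : set (p.-tuple T)) (B : set (q.-tuple T)) :
  measurable A -> measurable B ->
  power_prob (p + q) [set s | A (select (@lshift p q) (fun=> id) s) /\
                              B (select (@rshift p q) (fun=> id) s)] =
  (power_prob p A * power_prob q B)%E.
Proof.
move=> mA mB; pose c (z : p.-tuple T * q.-tuple T) : (p + q).-tuple T :=
  [tuple match fintype.split k with inl i => tnth z.1 i | inr j => tnth z.2 j end
   | k < p + q].
have mc : measurable_fun setT c.
  apply/measurable_fun_tnthP => k.
  rewrite (_ : _ \o _ = fun z => match fintype.split k with
    inl i => tnth z.1 i | inr j => tnth z.2 j end); last first.
    by apply/funext => z /=; rewrite tnth_mktuple.
  case: (fintype.split k) => i.
    by apply: (measurableT_comp (measurable_tnth i)); exact: measurable_fst.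
  by apply: (measurableT_comp (measurable_tnth i)); exact: measurable_snd.
pose mm := measure_function_pushforward__canonical__measure_function_Measure
  (product_measure1 (power_prob p) (power_prob q)) mc.
have mS n m (w : 'I_n -> 'I_m) : measurable_fun setT (select w (fun=> id)).
  exact: measurable_select.
rewrite -(@box_measure_unique _ _ _ _ mm (power_prob (p + q))) => [|||].
- rewrite /mm/= /pushforward -product_measure1E//; congr product_measure1.
  have cl z : select (@lshift p q) (fun=> id) (c z) = z.1.
    by apply: eq_from_tnth => i; rewrite !tnth_mktuple (unsplitK (inl i)).
  have cr z : select (@rshift p q) (fun=> id) (c z) = z.2.
    by apply: eq_from_tnth => i; rewrite !tnth_mktuple (unsplitK (inr i)).
  by apply/seteqP; split => z /=; rewrite /preimage/= cl cr.
- by rewrite /mm/= /pushforward preimage_setT probability_setT ltry.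
- move=> D mD; apply: etrans (esym (power_prob_box mD)).
  rewrite big_split_ord/= -!power_prob_box//.
  rewrite -product_measure1E; try exact: measurable_box.
  rewrite /mm/= /pushforward; congr product_measure1.
  apply/seteqP; split => z /=; rewrite /preimage/= /box/=.
    move=> zD; split => i.
      by have := zD (lshift q i); rewrite tnth_mktuple (unsplitK (inl i)).
    by have := zD (rshift p i); rewrite tnth_mktuple (unsplitK (inr i)).
  move=> [zA zB] k; rewrite tnth_mktuple; case: split_ordP => i ->.
    exact: zA.
  exact: zB.
- apply: measurableI.
    by rewrite -[X in measurable X]setTI; exact: mS.
  by rewrite -[X in measurable X]setTI; exact: mS.
Qed.

(** As [w] and [w'] have disjoint ranges, they merge into one injective selection of [p + q]
    coordinates, which [power_prob_split] then factors. *)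
Lemma power_prob_select_indep (M p q : nat) (w : 'I_p -> 'I_M)
    (w' : 'I_q -> 'I_M) (h : 'I_p -> T -> T) (h' : 'I_q -> T -> T) :
  injective w -> injective w' -> (forall i j, w i != w' j) ->
  (forall l, measure_preserving (h l)) -> (forall l, measure_preserving (h' l)) ->
  forall A B, measurable A -> measurable B ->
  power_prob M (select w h @^-1` A `&` select w' h' @^-1` B) =
  (power_prob p A * power_prob q B)%E.
Proof.
move=> wI wI' ww' hP hP' A B mA mB.
pose k (x : 'I_(p + q)) := match fintype.split x with inl i => w i | inr j => w' j end.
pose g (x : 'I_(p + q)) := match fintype.split x with inl i => h i | inr j => h' j end.
rewrite -power_prob_split// -(@power_prob_select M (p + q) k g) => [|||].
- congr (power_prob _ _); apply/seteqP; split => s; rewrite /preimage/=.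
    move=> [sA sB]; split.
      rewrite (_ : select _ _ _ = select w h s)//; apply: eq_from_tnth => i.
      by rewrite !tnth_mktuple /k /g (unsplitK (inl i)).
    rewrite (_ : select _ _ _ = select w' h' s)//; apply: eq_from_tnth => i.
    by rewrite !tnth_mktuple /k /g (unsplitK (inr i)).
  move=> [sA sB]; split.
    rewrite (_ : select w h s = select (@lshift p q) (fun=> id) (select k g s))//.
    apply: eq_from_tnth => i.
    by rewrite !tnth_mktuple /k /g (unsplitK (inl i)).
  rewrite (_ : select w' h' s = select (@rshift p q) (fun=> id) (select k g s))//.
  apply: eq_from_tnth => i.
  by rewrite !tnth_mktuple /k /g (unsplitK (inr i)).
- move=> x y; rewrite /k; case: split_ordP => i ->; case: split_ordP => j ->.
  + by move=> /wI ->.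
  + by move=> /eqP; rewrite (negbTE (ww' i j)).
  + by move=> /esym/eqP; rewrite (negbTE (ww' j i)).
  + by move=> /wI' ->.
- by move=> x; rewrite /g; case: split_ordP.
- apply: measurableI; rewrite -[X in measurable X]setTI.
    exact: measurable_select.
  exact: measurable_select.
Qed.

Lemma measure_preserving_id : measure_preserving id.
Proof. by split=> // A mA; rewrite preimage_id. Qed.

Lemma measure_preserving_iter (h : T -> T) (n : nat) :
  measure_preserving h -> measure_preserving (iter n h).
Proof.
move=> [mh hP]; elim: n => [|n [mn nP]]; first exact: measure_preserving_id.
split=> [|A mA]; first exact: measurableT_comp.
have mhA : measurable (h @^-1` A) by rewrite -[X in measurable X]setTI; exact: mh.
by rewrite -(hP _ mA) -(nP _ mhA).
Qed.

Hypothesis borelT : standard_borel R T.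
Hypothesis nu0 : forall x, nu [set x] = 0%E.

(** After projection to two coordinates the measure is an integral of masses of sections; each
    section is a single point, and [nu] has no atoms. *)
Lemma power_prob_graph0 (M : nat) (i j : 'I_M) (h : T -> T) :
  i != j -> measurable_fun setT h ->
  power_prob M [set s | tnth s i = h (tnth s j)] = 0%E.
Proof.
(* [j] is put first because the integral that defines [power_measure] fixes the head of the
   tuple. *)
move=> ij mh; pose w (l : 'I_2) := if l == ord0 then j else i.
pose B : set (2.-tuple T) := [set t | tnth t ord_max = h (tnth t ord0)].
have mB : measurable B.
  apply: (measurable_eq_fun borelT); first exact: measurable_tnth.
  by apply: measurableT_comp => //; exact: measurable_tnth.
rewrite (_ : mkset _ = select w (fun=> id) @^-1` B); last first.
  by apply/seteqP; split => s; rewrite /B /preimage/= !tnth_mktuple.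
rewrite power_prob_select//; last first.
  have wE l : (w l == j) = (l == ord0).
    by rewrite /w; case: (l == ord0); rewrite ?eqxx// (negbTE ij).
  move=> x y xy; have := wE x; rewrite xy wE.
  by case: x y {xy} => [[|[|//]] ?] [[|[|//]] ?] //= _; apply/val_inj.
rewrite -power_probE [LHS]/= /pushforward /product_measure1/=.
apply: integral0_eq => x _; rewrite -[LHS]/(power_measure nu (p := 1) _).
rewrite power_probE.
have m1 : measurable [set h x].
  rewrite (_ : [set _] = [set y | id y = cst (h x) y])//.
  exact: (measurable_eq_fun borelT).
rewrite (_ : xsection _ _ = box (fun=> [set h x])); last first.
  apply/seteqP; split => t; rewrite /xsection/= ?inE /B /preimage/=.
    by move=> tx k; rewrite ord1 -tx (tnth_nth x)/= (tnth_nth x).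
  by move=> /(_ ord0) /=; rewrite !(tnth_nth x)/= => <-.
by rewrite power_prob_box// big_ord_recl big_ord0 nu0 mul0e.
Qed.

End power_prob.

(** * Expectations and counting *)

Section mean.
Context (R : realType) (d : measure_display) (T : measurableType d).
Variable P : probability T R.

Definition has_mean (h : T -> R) (e : R) : Prop :=
  P.-integrable setT (EFin \o h) /\ (\int[P]_x (h x)%:E = e%:E)%E.

Lemma has_mean_indic (A : set T) :
  measurable A -> has_mean \1_A (fine (P A)).
Proof.
move=> mA; split; first exact: integrable_indic.
by rewrite integral_indic// setIT fineK// fin_num_measure.
Qed.

Lemma has_mean_cst (r : R) : has_mean (cst r) r.
Proof.
split; first exact: finite_measure_integrable_cst.
by rewrite -[LHS]/(\int[P]_x cst r%:E x)%E integral_cst//= probability_setT mule1.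
Qed.

Lemma has_meanD (h1 h2 : T -> R) (e1 e2 : R) :
  has_mean h1 e1 -> has_mean h2 e2 -> has_mean (h1 \+ h2) (e1 + e2).
Proof.
move=> [i1 m1] [i2 m2]; split.
  by rewrite (_ : _ \o _ = (EFin \o h1) \+ (EFin \o h2))%E//; exact: integrableD.
by under eq_integral do rewrite EFinD; rewrite integralD// m1 m2.
Qed.

Lemma has_meanZ (r : R) (h : T -> R) (e : R) :
  has_mean h e -> has_mean (fun x => r * h x) (r * e).
Proof.
move=> [ih mh]; split.
  by rewrite (_ : _ \o _ = fun x => r%:E * (EFin \o h) x)%E//; exact: integrableZl.
by under eq_integral do rewrite EFinM; rewrite integralZl// mh.
Qed.

Lemma has_mean_sum (I : finType) (h : I -> T -> R) (e : I -> R) :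
  (forall i, has_mean (h i) (e i)) ->
  has_mean (fun x => \sum_i h i x) (\sum_i e i).
Proof.
move=> hm; elim: (index_enum I) => [|i s IH].
  under eq_fun do rewrite big_nil.
  by rewrite big_nil; exact: has_mean_cst.
under eq_fun do rewrite big_cons.
by rewrite big_cons; exact: has_meanD.
Qed.

(** First-moment method: this extracts a good sample from a bound on an expectation. *)
Lemma has_mean_exists_lt (h : T -> R) (e r : R) :
  has_mean h e -> e < r -> exists x, h x < r.
Proof.
move=> [ih mh] er; apply: contrapT => /forallNP hr.
have : (r%:E <= e%:E)%E.
  have [ir mr] := has_mean_cst r.
  rewrite -mr -mh; apply: le_integral => // x _; rewrite lee_fin leNgt.
  exact/negP/hr.
by rewrite lee_fin leNgt er.
Qed.

End mean.

(** The product of [A i] with [M] values embeds into [X] through [h i], so [A i] holds at most a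
    fraction [1 / M] of [X]; summing over the cover bounds [S]. *)
Lemma card_cover_le (X I : finType) (M : nat) (S : {set X}) (A : I -> {set X})
    (h : I -> X -> 'I_M -> X) :
  (forall x, x \in S -> exists i, x \in A i) ->
  (forall i x y m k, x \in A i -> y \in A i -> h i x m = h i y k ->
     x = y /\ m = k) ->
  (#|S| * M <= #|I| * #|X|)%N.
Proof.
move=> SA hI.
have AM i : (#|A i| * M <= #|X|)%N.
  have -> : (#|A i| * M = #|finset.setX (A i) [set: 'I_M]%SET|)%N.
    by rewrite cardsX cardsT card_ord.
  apply: (@leq_card_in _ _ (fun z : X * 'I_M => h i z.1 z.2)).
  move=> [x m] [y k]; rewrite !inE/= !andbT => xA yA /(hI _ _ _ _ _ xA yA).
  by case=> -> ->.
have SAle : (#|S| <= \sum_i #|A i|)%N.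
  rewrite -sum1_card big_mkcond/=.
  under [leqRHS]eq_bigr do rewrite -sum1_card big_mkcond.
  rewrite exchange_big/=; apply: leq_sum => x _; case: ifPn => // /SA[i xAi].
  by rewrite (bigD1 i)//= xAi.
apply: (leq_trans (leq_mul SAle (leqnn M))); rewrite big_distrl/=.
by rewrite -sum_nat_const; exact: leq_sum.
Qed.

(** The cover is by pairs of positions [i != j] with the same index. Overwriting the index at [i]
    loses nothing, since it can be read off at [j]. *)
Lemma card_tuple_collision (M q : nat) (E : finType) :
  (#|[set w : q.-tuple ('I_M * E) | ~~ uniq [seq x.1 | x <- w]]%SET| * M <=
   q ^ 2 * #|{: q.-tuple ('I_M * E)}|)%N.
Proof.
rewrite -mulnn -[X in (X * X * _)%N]card_ord -card_prod.
pose A (z : 'I_q * 'I_q) := [set w : q.-tuple ('I_M * E) |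
  (z.1 != z.2) && ((tnth w z.1).1 == (tnth w z.2).1)]%SET.
pose h (z : 'I_q * 'I_q) (w : q.-tuple ('I_M * E)) (m : 'I_M) :=
  [tuple if k == z.1 then (m, (tnth w k).2) else tnth w k | k < q].
apply: (@card_cover_le _ _ _ _ A h) => [w|[i j] v w m k].
  rewrite inE; apply: contraNP => /forallNP Aw.
  rewrite -[X in map _ X](map_tnth_enum w) -map_comp map_inj_uniq ?enum_uniq//.
  move=> i j /= wij; apply/eqP; apply: contrapT => /negP ij.
  by apply: (Aw (i, j)); rewrite inE/= ij wij eqxx.
rewrite !inE/= => /andP[ij /eqP v12] /andP[_ /eqP w12] hE.
have E' l : tnth (h (i, j) v m) l = tnth (h (i, j) w k) l by rewrite hE.
have mk : m = k by have := E' i; rewrite !tnth_mktuple eqxx => -[].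
have ne l : l != i -> tnth v l = tnth w l.
  by move=> li; have := E' l; rewrite !tnth_mktuple/= (negbTE li).
split => //; apply: eq_from_tnth => l; have [->|/ne//] := eqVneq l i.
have ji : j != i by rewrite eq_sym.
rewrite [LHS]surjective_pairing [RHS]surjective_pairing v12 w12 (ne _ ji).
by have := E' i; rewrite !tnth_mktuple eqxx => -[_ ->].
Qed.

(** * Second moment of the empirical frequencies *)

Section sampling.
Context (R : realType) (d : measure_display) (T : measurableType d).
Variables (nu : probability T R) (M : nat) (E : finType) (act : E -> T -> T).
Hypothesis actP : forall e, measure_preserving nu (act e).

Definition sample (p : nat) (v : p.-tuple ('I_M * E)) : M.-tuple T -> p.-tuple T :=
  select (fun l => (tnth v l).1) (fun l => act (tnth v l).2).

Definition frequency (p : nat) (B : set (p.-tuple T)) (s : M.-tuple T) : R :=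
  (\sum_(v : p.-tuple ('I_M * E)) \1_B (sample v s)) /
  #|{: p.-tuple ('I_M * E)}|%:R.

(** The square expands into covariances over pairs of tuples. A pair in which no sample index
    repeats is independent and contributes zero; the other pairs are few and contribute at most 2
    each. *)
Lemma second_moment_frequency (p : nat) (B : set (p.-tuple T)) :
  measurable B -> (0 < M)%N -> (0 < #|E|)%N ->
  exists2 e, has_mean (power_prob nu M)
    (fun s => (frequency B s - fine (power_prob nu p B)) ^+ 2) e &
    e <= (2 * (p + p) ^ 2)%:R / M%:R.
Proof.
move=> mB M0 E0; set m := fine _; set n := #|{: p.-tuple ('I_M * E)}|.
have n0 : (0 < n)%N.
  by rewrite /n card_tuple card_prod card_ord expn_gt0 muln_gt0 M0 E0.
have nR : n%:R != 0 :> R by rewrite pnatr_eq0 -lt0n.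
pose Bv (v : p.-tuple ('I_M * E)) := sample v @^-1` B.
have mBv v : measurable (Bv v).
  rewrite -[X in measurable X]setTI; apply: measurable_select => // l.
  by have [] := actP (tnth v l).2.
pose mu := power_prob nu M.
have mu1 A : measurable A -> 0 <= fine (mu A) <= 1.
  move=> mA; rewrite fine_ge0 ?measure_ge0//= -lee_fin fineK ?fin_num_measure//.
  exact: probability_le1.
have m01 : 0 <= m <= 1.
  rewrite fine_ge0 ?measure_ge0//= -lee_fin fineK ?fin_num_measure//.
  exact: probability_le1.
(* [e z] is the mean of [f z], the expanded product of the two centred indicators. *)
pose e (z : p.-tuple ('I_M * E) * p.-tuple ('I_M * E)) : R :=
  fine (mu (Bv z.1 `&` Bv z.2)) + (- m * fine (mu (Bv z.1)) +
  (- m * fine (mu (Bv z.2)) + m ^+ 2)).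
pose f (z : p.-tuple ('I_M * E) * p.-tuple ('I_M * E)) (s : M.-tuple T) : R :=
  \1_(Bv z.1 `&` Bv z.2) s + (- m * \1_(Bv z.1) s +
  (- m * \1_(Bv z.2) s + m ^+ 2)).
exists (n%:R ^- 2 * \sum_z e z).
  rewrite (_ : (fun s => _) = fun s => n%:R ^- 2 * \sum_z f z s).
    apply: has_meanZ; apply: has_mean_sum => z.
    apply: has_meanD; first by apply: has_mean_indic; exact: measurableI.
    apply: has_meanD; first by apply: has_meanZ; exact: has_mean_indic.
    apply: has_meanD; first by apply: has_meanZ; exact: has_mean_indic.
    exact: has_mean_cst.
  apply/funext => s.
  have -> : frequency B s - m = n%:R^-1 * \sum_v (\1_(Bv v) s - m).
    rewrite sumrB sumr_const -/n mulrBr; congr (_ - _); first exact: mulrC.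
    by rewrite -(mulr_natl m) mulKf.
  rewrite exprMn exprVn; congr (_ * _).
  rewrite expr2 big_distrlr/= pair_bigA/=; apply: eq_bigr => z _.
  by rewrite /f indicI/=; ring.
pose S := [set z : p.-tuple ('I_M * E) * p.-tuple ('I_M * E) |
  ~~ uniq [seq x.1 | x <- z.1 ++ z.2]]%SET.
have e0 z : z \notin S -> e z = 0.
  rewrite inE negbK map_cat cat_uniq => /and3P[u1 u12 u2].
  have uI (v : p.-tuple ('I_M * E)) : uniq [seq x.1 | x <- v] ->
      injective (fun l => (tnth v l).1).
    move=> uv i j ij; have := (ltn_ord i, ltn_ord j) => -[? ?]; apply/val_inj/eqP.
    rewrite -(@nth_uniq _ (tnth v i).1 [seq x.1 | x <- v]) ?size_map ?size_tuple//.
    rewrite !(nth_map (tnth v i)) ?size_tuple//.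
    by rewrite -!tnth_nth ij.
  have Bm (u : p.-tuple _) : uniq [seq x.1 | x <- u] ->
      mu (Bv u) = power_prob nu p B.
    move=> /uI vI; exact: power_prob_select.
  have Bmm : mu (Bv z.1 `&` Bv z.2) = (power_prob nu p B * power_prob nu p B)%E.
    apply: power_prob_select_indep => //; [exact: uI|exact: uI|].
    move=> i j; apply: contraNN u12 => /eqP ij; apply/hasP => /=.
    exists (tnth z.1 i).1; last by apply: map_f; exact: mem_tnth.
    by rewrite ij; apply: map_f; exact: mem_tnth.
  rewrite /e Bmm !Bm// fineM ?fin_num_measure// -/m; ring.
have e2 z : e z <= 2.
  have /andP[? ?] := mu1 _ (measurableI _ _ (mBv z.1) (mBv z.2)).
  have /andP[a0 ?] := mu1 _ (mBv z.1); have /andP[b0 ?] := mu1 _ (mBv z.2).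
  have /andP[m0 m1] := m01.
  have ? := mulr_ge0 m0 a0; have ? := mulr_ge0 m0 b0.
  have : m ^+ 2 <= 1 by rewrite expr_le1.
  rewrite /e !mulNr; lra.
(* Concatenating a pair gives a tuple of length [p + p], to which the collision count applies. *)
have SM : (#|S| * M <= (p + p) ^ 2 * (n * n))%N.
  have := card_tuple_collision M (p + p) E.
  rewrite [X in (_ <= _ * X)%N -> _]card_tuple expnD -card_tuple.
  apply: leq_trans; rewrite leq_mul2r; apply/orP; right.
  rewrite -(card_in_imset (f := fun z : p.-tuple ('I_M * E) * p.-tuple ('I_M * E) =>
    [tuple of z.1 ++ z.2])); last first.
    move=> [a b] [a' b'] _ _ /(congr1 val)/eqP /=.
    by rewrite eqseq_cat ?size_tuple// => /andP[/eqP/val_inj -> /eqP/val_inj ->].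
  apply: subset_leq_card; apply/fintype.subsetP => _ /imsetP[z zS ->].
  by rewrite inE in zS; rewrite inE.
have -> : \sum_z e z = \sum_(z in S) e z.
  by rewrite (bigID (mem S))/= [X in _ + X]big1 ?addr0// => z /e0.
apply: (@le_trans _ _ (n%:R ^- 2 * (2 * #|S|%:R))).
  rewrite ler_pM2l ?invr_gt0 ?exprn_gt0 ?ltr0n//.
  rewrite mulr_natr -sumr_const; exact: ler_sum.
rewrite ler_pdivlMr ?ltr0n// -mulrA ler_pdivrMl ?exprn_gt0 ?ltr0n//.
by rewrite -natrX -!natrM ler_nat; move: SM; rewrite -mulnn; nia.
Qed.

End sampling.

(** * The finite mapping attached to a sample *)

Section period.
Variables (T : choiceType) (f : T -> T).

Lemma iter_period_mod (x : T) (k n : nat) :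
  iter k f x = x -> iter n f x = iter (n %% k) f x.
Proof.
move=> kx; rewrite {1}(divn_eq n k) addnC iterD; congr (iter _ f _).
by elim: (n %/ k)%N => //= q IH; rewrite mulSn iterD IH.
Qed.

(* The value is [1] at non-periodic points. *)
Definition period (x : T) : nat :=
  if pselect (exists k, (0 < k)%N && (iter k f x == x)) is left h
  then ex_minn h else 1.

(** The least positive return time divides every return time, since a nonzero remainder would be a
    smaller one. *)
Lemma periodP (x : T) (n : nat) : (0 < n)%N -> iter n f x = x ->
  [/\ (0 < period x)%N, iter (period x) f x = x &
      forall u v, iter u f x = iter v f x -> u = v %[mod period x]].
Proof.
move=> n0 nx; rewrite /period; case: pselect => [h|[]]; last first.
  by exists n; rewrite n0 nx eqxx.
case: ex_minnP => k /andP[k0 /eqP kx] kmin; split => // u v uv.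
have kdvd m : iter m f x = x -> (k %| m)%N.
  rewrite (iter_period_mod m kx) => mx; apply: contraT; rewrite /dvdn -lt0n => mk.
  by have := kmin (m %% k)%N; rewrite mk mx eqxx => /(_ isT); rewrite leqNgt ltn_pmod.
(* After [u] steps, [k * u - u] further steps lead back to [x]; adding as many to [v] therefore
   gives a return time. *)
have ku : (u <= k * u)%N by rewrite leq_pmull.
apply/eqP; rewrite -(eqn_modDl (k * u - u)) subnK// modnMr eq_sym.
apply: kdvd; rewrite iterD -uv -iterD subnK//.
by rewrite (iter_period_mod _ kx) modnMr.
Qed.

End period.

(** * Construction of the finite mapping and its comparison with the sampled orbits *)

Section finite_model.
Context (C : finType) (T : choiceType) (L : mapping C T).
Variables (M P r : nat) (s : M.+1.-tuple T).
Hypothesis r_lt_P : (r < P.+1)%N.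
Hypothesis dvd_P : forall b, (0 < b <= r)%N -> (b %| P.+1)%N.

Local Notation f := (mp_fun L).
Local Notation D := ('I_M.+1 * ('I_P.+1 * 'I_M.+1))%type.

(** Only points whose period divides [P.+1] move. By [dvd_P] the other points have no return time
    between 1 and [r], so at depth [r] they behave like aperiodic ones. *)
Definition rotate (j : nat) (x : T) : T :=
  if iter P.+1 f x == x then iter j f x else x.

Definition point (z : D) : T :=
  if z.2.2 == ord0 then iter z.2.1 f (tnth s z.1)
  else rotate z.2.1 (tnth s z.1).

(** The choice depends on [y] alone, so orbits of different samples that merge in [L] also merge in
    the model. *)
Definition code (y : T) : option D :=
  omap (fun e : 'I_M.+1 * 'I_P.+1 => (e.1, (e.2, ord0)))
    [pick e : 'I_M.+1 * 'I_P.+1 | iter e.2 f (tnth s e.1) == y].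

(** A cyclic shift by [a] inside the block of [k] consecutive integers that contains [j]; these
    blocks tile the integers below [P.+1] when [k] divides it. *)
Definition turn (k j a : nat) : nat := (k * (j %/ k) + (j + a) %% k)%N.

(* The points [(i, (j, c))] with [c != 0] are [M] copies of
   [rotate j (tnth s i)], those with [c = 0] carry the forward orbits of the
   samples. When [tnth s i] is periodic, the interval of values of [j] is cut
   into cycles whose length is its exact period. *)
Definition model_fun (z : D) : D :=
  let x := tnth s z.1 in
  if (z.2.2 != ord0) && (iter P.+1 f x == x)
  then (z.1, (inord (turn (period f x) z.2.1 1), z.2.2))
  else odflt z (code (f (point z))).

Definition model : mapping C D :=
  Mapping model_fun (fun c => [set z | mp_color L c (point z)]).

(** This keeps the default value in [model_fun] from being reached along the first [P.+1] points of
    the orbit of a sample. *)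
Lemma code_iter (i : 'I_M.+1) (a : nat) : (a < P.+1)%N ->
  exists2 z, code (iter a f (tnth s i)) = Some z &
    point z = iter a f (tnth s i) /\ z.2.2 = ord0.
Proof.
move=> aP; rewrite /code; case: pickP => /= [e /eqP eE|/(_ (i, inord a))/=].
  by eexists; first by []; split => //; rewrite /point/=.
by rewrite inordK// eqxx.
Qed.

(** The first step sends every copy of the sample to the reserved element that codes its image, and
    later steps pass from code to code. The exponent 0 is excluded because a copy is not itself a
    reserved element. *)
Lemma iter_model_aperiodic (z : D) (a : nat) :
  z.2.2 != ord0 -> iter P.+1 f (tnth s z.1) != tnth s z.1 -> (0 < a < P.+1)%N ->
  Some (iter a model_fun z) = code (iter a f (tnth s z.1)).
Proof.
move=> z0 zx; elim: a => // -[|a] IH aP; last first.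
  have aP' : (a.+1 < P.+1)%N by apply: ltn_trans aP.
  have [u uE [up u0]] := code_iter z.1 aP'.
  have [u' u'E _] := code_iter z.1 aP.
  have := IH aP'; rewrite uE => /Some_inj zu.
  by rewrite iterS zu /model_fun u0 eqxx/= up -iterS u'E.
have [u uE _] := code_iter z.1 aP.
rewrite /= {1}/model_fun z0 (negbTE zx)/= /point (negbTE z0) /rotate (negbTE zx).
by rewrite -[f _]/(iter 1 f _) uE.
Qed.

Lemma turn_lt (k j a : nat) : (0 < k)%N -> (k %| P.+1)%N -> (j < P.+1)%N ->
  (turn k j a < P.+1)%N.
Proof.
move=> k0 /dvdnP[q Pq] jP.
have : (j %/ k < q)%N by rewrite ltn_divLR// -Pq.
have := ltn_pmod (j + a) k0; rewrite Pq /turn; nia.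
Qed.

Lemma turn_mod (k j a : nat) : turn k j a = j + a %[mod k].
Proof. by rewrite /turn mulnC modnMDl modn_mod. Qed.

Lemma turn0 (k j : nat) : turn k j 0 = j.
Proof. by rewrite /turn addn0 mulnC -divn_eq. Qed.

Lemma turnS (k j a : nat) : (0 < k)%N -> turn k (turn k j a) 1 = turn k j a.+1.
Proof.
move=> k0; rewrite {1}/turn; congr (k * _ + _)%N.
  by rewrite /turn mulnC divnMDl// (divn_small (ltn_pmod _ k0)) addn0.
by rewrite -modnDml turn_mod modnDml -addnA addn1.
Qed.

Lemma turn_inj (k j a b : nat) : j + a = j + b %[mod k] -> turn k j a = turn k j b.
Proof. by rewrite /turn => ->. Qed.

Lemma iter_model_periodic (z : D) (a : nat) :
  z.2.2 != ord0 -> iter P.+1 f (tnth s z.1) == tnth s z.1 ->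
  iter a model_fun z =
  (z.1, (inord (turn (period f (tnth s z.1)) z.2.1 a), z.2.2)).
Proof.
move=> z0 zx; have [k0 kx kmod] := periodP (ltn0Sn P) (eqP zx).
have kP : (period f (tnth s z.1) %| P.+1)%N.
  by rewrite /dvdn; have /eqP := kmod P.+1 0%N (eqP zx); rewrite mod0n.
elim: a => [|a IH].
  by rewrite turn0 inord_val; case: z {z0 zx k0 kx kmod kP} => i [j c].
rewrite iterS IH /model_fun/= z0 zx/= inordK ?turnS//.
exact: turn_lt.
Qed.

(** On cycles this holds because [turn] adds [a] modulo the period, on other orbits because a code
    stands for the point that it encodes. *)
Lemma point_iter_model (z : D) (a : nat) : z.2.2 != ord0 -> (a <= r)%N ->
  point (iter a model_fun z) = iter a f (point z).
Proof.
move=> z0 ar; have [zx|zx] := boolP (iter P.+1 f (tnth s z.1) == tnth s z.1).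
  have [k0 kx kmod] := periodP (ltn0Sn P) (eqP zx).
  have kP : (period f (tnth s z.1) %| P.+1)%N.
    by rewrite /dvdn; have /eqP := kmod P.+1 0%N (eqP zx); rewrite mod0n.
  rewrite iter_model_periodic// /point/= (negbTE z0) /rotate zx inordK.
    by rewrite (iter_period_mod _ kx) turn_mod -(iter_period_mod _ kx) addnC iterD.
  exact: turn_lt.
case: a ar => // a ar; have aP : (0 < a.+1 < P.+1)%N by exact: leq_ltn_trans r_lt_P.
have [u uE [up _]] := code_iter z.1 (andP aP).2.
have := iter_model_aperiodic z0 zx aP; rewrite uE => /Some_inj ->.
by rewrite up /point (negbTE z0) /rotate (negbTE zx).
Qed.

Hypothesis s_free : forall (i j : 'I_M.+1) b, i != j ->
  tnth s i <> iter b f (tnth s j).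

(** From [iter a f x], another [n * a - a] steps complete full turns of the cycle and lead back to
    [x]. *)
Lemma iter_back (x y : T) (n a b : nat) : (0 < n)%N -> iter n f x = x ->
  iter a f x = iter b f y -> exists c, x = iter c f y.
Proof.
move=> n0 nx ab; exists (n * a - a + b)%N.
rewrite iterD -ab -iterD subnK; first by rewrite (iter_period_mod _ nx) modnMr.
by rewrite leq_pmull.
Qed.

Lemma rotate_iter (j : nat) (x : T) : exists c, rotate j x = iter c f x.
Proof. by rewrite /rotate; case: ifP => _; [exists j|exists 0%N]. Qed.

(** The direct implication is [point_iter_model]. For the converse, a single sample on a cycle is
    settled by the period, as [turn] depends on the exponent only modulo it; off cycles, both sides
    are codes of one point as soon as both exponents are positive. *)
Lemma iter_model_eq (z w : D) (a b : nat) :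
  z.2.2 != ord0 -> w.2.2 != ord0 -> (z.1 = w.1 -> z = w) ->
  (a <= r)%N -> (b <= r)%N ->
  iter a model_fun z = iter b model_fun w <->
  iter a f (point z) = iter b f (point w).
Proof.
move=> z0 w0 zw ar br; split=> [zE|].
  by rewrite -!point_iter_model// zE.
have ptE (u : D) : u.2.2 != ord0 -> point u = rotate u.2.1 (tnth s u.1).
  by move=> u0; rewrite /point (negbTE u0).
have codeE (u : D) e : u.2.2 != ord0 ->
    iter P.+1 f (tnth s u.1) != tnth s u.1 -> (0 < e <= r)%N ->
    Some (iter e model_fun u) = code (iter e f (point u)).
  move=> u0 ux /andP[e0 er]; rewrite ptE// /rotate (negbTE ux).
  by apply: iter_model_aperiodic => //; rewrite e0 (leq_ltn_trans er).
rewrite !ptE//; have [zw1|zw1] := eqVneq z.1 w.1.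
  have ? := zw zw1; subst w; clear w0 zw zw1.
  have [zx|zx] := boolP (iter P.+1 f (tnth s z.1) == tnth s z.1).
    have [k0 kx kmod] := periodP (ltn0Sn P) (eqP zx).
    rewrite !iter_model_periodic// /rotate zx -!iterD => /kmod.
    rewrite ![(_ + z.2.1)%N]addnC => /turn_inj ->//.
  move=> E; apply: Some_inj; move: E; rewrite -ptE//.
  (* A return time [e <= r] would divide [P.+1], against [zx]. *)
  have nper e : (0 < e <= r)%N -> point z <> iter e f (point z).
    rewrite ptE// /rotate (negbTE zx) => er xe; case/eqP: zx.
    by rewrite (iter_period_mod P.+1 (esym xe)) (eqP (dvd_P er)).
  case: a b ar br => [|a] [|b] ar br //.
  - by move=> /nper; rewrite br => /(_ isT).
  - by move=> /esym/nper; rewrite ar => /(_ isT).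
  - by move=> E; rewrite !codeE// E.
(* For different samples, a periodic one or a zero exponent would put one sample on the forward
   orbit of the other, against [s_free]. In the remaining case both sides are codes of the same
   point. *)
move=> E; have [c zc] := rotate_iter z.2.1 (tnth s z.1).
have [c' wc] := rotate_iter w.2.1 (tnth s w.1).
have E' : iter (a + c) f (tnth s z.1) = iter (b + c') f (tnth s w.1).
  by rewrite !iterD -zc -wc.
have [zx|zx] := eqVneq (iter P.+1 f (tnth s z.1)) (tnth s z.1).
  by have [e /(s_free zw1)] := iter_back (ltn0Sn P) zx E'.
have [wx|wx] := eqVneq (iter P.+1 f (tnth s w.1)) (tnth s w.1).
  by have [e /s_free] := iter_back (ltn0Sn P) wx (esym E'); rewrite eq_sym => /(_ zw1).
apply: Some_inj; move: E; rewrite -!ptE//.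
case: a b ar br {E'} => [|a] [|b] ar br.
- by rewrite !ptE// /rotate (negbTE zx) (negbTE wx) => /(@s_free _ _ 0 zw1).
- by rewrite !ptE// /rotate (negbTE zx) (negbTE wx) => /(@s_free _ _ b.+1 zw1).
- rewrite !ptE// /rotate (negbTE zx) (negbTE wx) => /esym/(@s_free _ _ a.+1).
  by rewrite eq_sym => /(_ zw1).
- by move=> E; rewrite !codeE// E.
Qed.

End finite_model.

(** * Quantifier-free formulas *)

Section formulas.
Variable C : finType.

Fixpoint term_depth (p : nat) (t : qf_term p) : nat :=
  if t is App u then (term_depth u).+1 else 0.

Fixpoint term_var (p : nat) (t : qf_term p) : 'I_p :=
  match t with Var i => i | App u => term_var u end.

Fixpoint formula_depth (p : nat) (phi : qf_formula C p) : nat :=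
  match phi with
  | QFalse => 0
  | QEq t u => maxn (term_depth t) (term_depth u)
  | QColor _ t => term_depth t
  | QNot psi => formula_depth psi
  | QAnd psi chi => maxn (formula_depth psi) (formula_depth chi)
  | QOr psi chi => maxn (formula_depth psi) (formula_depth chi)
  end.

Lemma qf_evalE (F : Type) (m : mapping C F) (p : nat) (v : 'I_p -> F)
    (t : qf_term p) :
  qf_eval m v t = iter (term_depth t) (mp_fun m) (v (term_var t)).
Proof. by elim: t => //= t ->. Qed.

Lemma qf_sat_transfer (F G : Type) (m : mapping C F) (n : mapping C G)
    (p r : nat) (v : 'I_p -> F) (w : 'I_p -> G) (phi : qf_formula C p) :
  (forall i j a b, (a <= r)%N -> (b <= r)%N ->
     iter a (mp_fun m) (v i) = iter b (mp_fun m) (v j) <->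
     iter a (mp_fun n) (w i) = iter b (mp_fun n) (w j)) ->
  (forall c i a, (a <= r)%N ->
     mp_color m c (iter a (mp_fun m) (v i)) <->
     mp_color n c (iter a (mp_fun n) (w i))) ->
  (formula_depth phi <= r)%N ->
  qf_sat m v phi <-> qf_sat n w phi.
Proof.
move=> eqP colP; elim: phi => //=.
- by move=> t u; rewrite geq_max !qf_evalE => /andP[]; exact: eqP.
- by move=> c t; rewrite !qf_evalE; exact: colP.
- by move=> psi IH /IH; tauto.
- by move=> psi IH1 chi IH2; rewrite geq_max => /andP[/IH1 ? /IH2]; tauto.
- by move=> psi IH1 chi IH2; rewrite geq_max => /andP[/IH1 ? /IH2]; tauto.
Qed.

Lemma measurable_fun_iter (d : measure_display) (T : measurableType d)
    (f : T -> T) (n : nat) :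
  measurable_fun setT f -> measurable_fun setT (iter n f).
Proof. by move=> mf; elim: n => [|n IH]; [exact: measurable_id|exact: (measurableT_comp mf IH)]. Qed.

(** Equality atoms are where the standard Borel structure enters, through [measurable_eq_fun]. *)
Lemma measurable_solutions (R : realType) (d : measure_display)
    (T : measurableType d) (m : mapping C T) (p : nat) (phi : qf_formula C p) :
  standard_borel R T -> measurable_fun setT (mp_fun m) ->
  (forall c, measurable (mp_color m c)) -> measurable (solutions m phi).
Proof.
move=> borelT mf mC.
have mt (t : qf_term p) :
    measurable_fun setT (fun v : p.-tuple T => qf_eval m (tnth v) t).
  under eq_fun do rewrite qf_evalE.
  apply: (@measurableT_comp _ _ _ _ _ _ (iter (term_depth t) (mp_fun m))).
    exact: measurable_fun_iter.
  exact: measurable_tnth.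
elim: phi => [|t u|c t|psi IH|psi IH1 chi IH2|psi IH1 chi IH2].
- by rewrite (_ : solutions _ _ = set0).
- exact: (measurable_eq_fun borelT).
- by rewrite -[X in measurable X]setTI; exact: mt.
- exact: measurableC.
- exact: measurableI.
- exact: measurableU.
Qed.

(** * Enumeration of the formulas *)

Definition term_of (p : nat) (z : nat * 'I_p) : qf_term p :=
  iter z.1 (@App p) (Var z.2).

Lemma term_ofK (p : nat) (t : qf_term p) : term_of (term_depth t, term_var t) = t.
Proof. by elim: t => //= t IH; rewrite -[in RHS]IH. Qed.

Fixpoint formula_encode (p : nat) (phi : qf_formula C p) :
    GenTree.tree (nat * 'I_p + C) :=
  let leaf t := GenTree.Leaf (inl (term_depth t, term_var t)) in
  match phi with
  | QFalse => GenTree.Node 0 [::]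
  | QEq t u => GenTree.Node 1 [:: leaf t; leaf u]
  | QColor c t => GenTree.Node 2 [:: GenTree.Leaf (inr c); leaf t]
  | QNot psi => GenTree.Node 3 [:: formula_encode psi]
  | QAnd psi chi => GenTree.Node 4 [:: formula_encode psi; formula_encode chi]
  | QOr psi chi => GenTree.Node 5 [:: formula_encode psi; formula_encode chi]
  end.

Fixpoint formula_decode (p : nat) (t : GenTree.tree (nat * 'I_p + C)) :
    qf_formula C p :=
  match t with
  | GenTree.Node 1 [:: GenTree.Leaf (inl a); GenTree.Leaf (inl b)] =>
      QEq _ (term_of a) (term_of b)
  | GenTree.Node 2 [:: GenTree.Leaf (inr c); GenTree.Leaf (inl a)] =>
      QColor c (term_of a)
  | GenTree.Node 3 [:: a] => QNot (formula_decode a)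
  | GenTree.Node 4 [:: a; b] => QAnd (formula_decode a) (formula_decode b)
  | GenTree.Node 5 [:: a; b] => QOr (formula_decode a) (formula_decode b)
  | _ => QFalse C p
  end.

Lemma formula_encodeK (p : nat) : cancel (@formula_encode p) (@formula_decode p).
Proof.
by elim=> //= [t u|c t|? ->|? -> ? ->|? -> ? ->] //; rewrite !term_ofK.
Qed.

(** Only surjectivity matters for the diagonal argument, so numbers that code no tree go to
    [QFalse]. *)
Definition formula_enum (p n : nat) : qf_formula C p :=
  if unpickle n is Some t then formula_decode t else QFalse C p.

Lemma formula_enumP (p : nat) (phi : qf_formula C p) :
  exists n, formula_enum p n = phi.
Proof.
exists (pickle (formula_encode phi)).
by rewrite /formula_enum pickleK formula_encodeK.
Qed.

End formulas.

Lemma dist_card_le (R : realDomainType) (X : finType) (A B : pred X) (S : {set X}) :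
  (forall x, x \notin S -> A x = B x) ->
  `|\sum_x (A x)%:R - \sum_x (B x)%:R| <= #|S|%:R :> R.
Proof.
move=> AB; rewrite -sumrB; apply: le_trans (ler_norm_sum _ _ _) _.
rewrite -sum1_card natr_sum [leRHS]big_mkcond/=; apply: ler_sum => x _.
case: ifPn => [_|/AB ->]; last by rewrite subrr normr0.
by case: (A x) (B x) => -[]; rewrite ?subrr ?normr0 ?subr0 ?sub0r ?normrN ?normr1.
Qed.

(** The hypothesis concerns images, preservation concerns preimages. On [Z] the map [f] is a
    bijection with inverse [iter P f], which turns one into the other; off [Z] nothing moves. *)
Lemma rotate_preserving (R : realType) (C : finType) (L : borel_mapping R C)
    (P j : nat) :
  (forall X : set (bm_dom L), measurable X -> X `<=` cyclic_elements L ->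
     bm_prob L (mp_fun L @` X) = bm_prob L X) ->
  measure_preserving (bm_prob L) (rotate L P j).
Proof.
move=> Linv; set f := mp_fun L; have mf : measurable_fun setT f by exact: bm_fun_measurable.
pose Z := [set x | iter P.+1 f x = x].
have mZ : measurable Z.
  by apply: (measurable_eq_fun (bm_standard L)) => //; exact: measurable_fun_iter.
have Zf x : Z x -> Z (f x) by rewrite /Z/= -iterSr iterS => ->.
(* [Z] is stable under [f], so it suffices to treat the rotation by one step. *)
have -> : rotate L P j = iter j (rotate L P 1).
  apply/funext => x; rewrite /rotate; have [xZ|xZ] := eqVneq (iter P.+1 f x) x.
    have : Z (iter j f x) /\
      iter j (fun x => if iter P.+1 f x == x then iter 1 f x else x) x = iter j f x.
      elim: j => //= j [Zj ->]; split; first exact: Zf.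
      by rewrite -[f (iter P f _)]/(iter P.+1 f _) Zj eqxx.
    by case.
  by elim: j => // j IH; rewrite iterS -IH (negbTE xZ).
apply: measure_preserving_iter; split.
  apply: measurable_fun_ifT => //.
  apply: (@measurable_fun_bool _ _ _ _ true); rewrite setTI.
  rewrite (_ : _ @^-1` _ = Z)//.
  by apply/seteqP; split => x /= /eqP.
move=> A mA.
have mfA : measurable (f @^-1` A) by rewrite -[X in measurable X]setTI; exact: mf.
have -> : rotate L P 1 @^-1` A = (f @^-1` A `&` Z) `|` (A `\` Z).
  apply/seteqP; split => x; rewrite /preimage /rotate/=.
    by case: eqP => xZ xA; [left|right].
  by case=> -[]; rewrite /Z/=; case: eqP.
have fX : f @` (f @^-1` A `&` Z) = A `&` Z.
  apply/seteqP; split => [_ [x [xA xZ] <-]|x [xA xZ]]; first by split => //; exact: Zf.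
  exists (iter P f x); last by rewrite -[f _]/(iter P.+1 f x).
  split; first by rewrite /preimage/= -[f _]/(iter P.+1 f x) xZ.
  by rewrite /Z/mkset -iterD addnC iterD xZ.
rewrite measureU//; last 3 first.
- exact: measurableI.
- exact: measurableD.
- by apply/seteqP; split => x // [[_ xZ] [_ /(_ xZ)]].
have E : bm_prob L (f @^-1` A `&` Z) = bm_prob L (A `&` Z).
  rewrite -fX; apply/esym/Linv; first exact: measurableI.
  by move=> x [_ xZ]; exists P.+1.
by rewrite [RHS](measureDI (bm_prob L) mA mZ) addeC; congr (_ + _)%E; exact: E.
Qed.

(** * Approximation *)

(** Overwriting a component known to be [ord0] loses nothing, so tuples that contain a reserved
    element form a fraction at most [p / M.+1]. *)
Lemma card_tuple_reserved (M p : nat) (A B : finType) :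
  (#|[set w : p.-tuple (A * (B * 'I_M.+1)) |
      [exists l, (tnth w l).2.2 == ord0]]%SET| * M.+1 <=
   p * #|{: p.-tuple (A * (B * 'I_M.+1))}|)%N.
Proof.
rewrite -[X in (_ <= X * _)%N]card_ord.
pose S (l : 'I_p) := [set w : p.-tuple (A * (B * 'I_M.+1)) |
  (tnth w l).2.2 == ord0]%SET.
pose h (l : 'I_p) (w : p.-tuple (A * (B * 'I_M.+1))) (m : 'I_M.+1) :=
  [tuple if k == l then ((tnth w k).1, ((tnth w k).2.1, m)) else tnth w k | k < p].
apply: (@card_cover_le _ _ _ _ S h) => [w|l v w m k].
  by rewrite inE => /existsP[l wl]; exists l; rewrite inE.
rewrite !inE => /eqP vl /eqP wl hE.
have E' i : tnth (h l v m) i = tnth (h l w k) i by rewrite hE.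
have := E' l; rewrite !tnth_mktuple eqxx => -[vw1 vw2 mk]; split => //.
apply: eq_from_tnth => i; have [->|il] := eqVneq i l.
  by case: (tnth v l) (tnth w l) vl wl vw1 vw2 => [? [? ?]] [? [? ?]] /= -> -> -> ->.
by have := E' i; rewrite !tnth_mktuple (negbTE il).
Qed.

Section approximation.
Context (R : realType) (C : finType) (L : borel_mapping R C).
Variables (M P r : nat).
Hypothesis r_lt_P : (r < P.+1)%N.
Hypothesis dvd_P : forall b, (0 < b <= r)%N -> (b %| P.+1)%N.

Local Notation D := ('I_M.+1 * ('I_P.+1 * 'I_M.+1))%type.

(** The index combines offset and copy number, so that [frequency] averages over exactly the tuples
    of elements of the model. *)
Definition rotation (e : 'I_P.+1 * 'I_M.+1) : bm_dom L -> bm_dom L :=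
  rotate L P e.1.

Lemma model_card_gt0 : (0 < #|{: D}|)%N.
Proof. by rewrite !card_prod !card_ord. Qed.

Definition finite_model (s : M.+1.-tuple (bm_dom L)) : finite_mapping C :=
  FiniteMapping model_card_gt0 (model L P s).

(** Distinct sample indices supply the condition of [iter_model_eq] that two entries over the same
    sample coincide; [point_iter_model] handles the colors. *)
Lemma model_sat (s : M.+1.-tuple (bm_dom L)) (p : nat) (phi : qf_formula C p)
    (v : p.-tuple D) :
  (forall (i j : 'I_M.+1) b, i != j ->
     tnth s i <> iter b (mp_fun L) (tnth s j)) ->
  (formula_depth phi <= r)%N ->
  uniq [seq z.1 | z <- v] -> (forall l, (tnth v l).2.2 != ord0) ->
  solutions (model L P s) phi v <-> solutions L phi (sample rotation v s).
Proof.
move=> s_free phir uv v0.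
have ptE l : tnth (sample rotation v s) l = point L s (tnth v l).
  by rewrite tnth_mktuple /point (negbTE (v0 l)).
apply: qf_sat_transfer phir => [i j a b ar br|c i a ar].
  rewrite !ptE; apply: (iter_model_eq r_lt_P dvd_P s_free) => // vij.
  congr (tnth v _); apply/val_inj/eqP.
  have [? ?] := (ltn_ord i, ltn_ord j).
  rewrite -(@nth_uniq _ (tnth v i).1 [seq x.1 | x <- v]) ?size_map ?size_tuple//.
  rewrite !(nth_map (tnth v i)) ?size_tuple//.
  by rewrite -!tnth_nth vij.
by rewrite ptE -(@point_iter_model C _ L M P r s r_lt_P).
Qed.

(** Both quantities average over the same tuples, and by [model_sat] they can differ only where a
    sample index repeats or a reserved element occurs. *)
Lemma dist_density_frequency (s : M.+1.-tuple (bm_dom L)) (p : nat)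
    (phi : qf_formula C p) :
  (forall (i j : 'I_M.+1) b, i != j ->
     tnth s i <> iter b (mp_fun L) (tnth s j)) ->
  (formula_depth phi <= r)%N ->
  `|finite_density R phi (finite_model s) -
    frequency R rotation (solutions L phi) s| <= (p + p ^ 2)%:R / M.+1%:R.
Proof.
move=> s_free phir; rewrite /finite_density /frequency /=.
rewrite -natrX -card_tuple; set n := #|{: p.-tuple D}|.
have n0 : 0 < n%:R :> R.
  by rewrite ltr0n /n card_tuple expn_gt0 model_card_gt0.
rewrite -mulrBl normrM (@ger0_norm _ n%:R^-1) ?invr_ge0 ?ler0n//.
pose S1 := [set w : p.-tuple D | ~~ uniq [seq x.1 | x <- w]]%SET.
pose S2 := [set w : p.-tuple D | [exists l, (tnth w l).2.2 == ord0]]%SET.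
have S12 : (#|S1 :|: S2| * M.+1 <= (p + p ^ 2) * n)%N.
  apply: (@leq_trans ((#|S1| + #|S2|) * M.+1)).
    by rewrite leq_mul2r leq_card_setU orbT.
  rewrite !mulnDl addnC; apply: leq_add.
    exact: card_tuple_reserved.
  exact: card_tuple_collision.
apply: (@le_trans _ _ (#|S1 :|: S2|%:R / n%:R)); last first.
  rewrite ler_pdivrMr// mulrAC ler_pdivlMr ?ltr0n//.
  by rewrite -!natrM ler_nat.
rewrite ler_pM2r ?invr_gt0//.
have -> : #|[pred v in solutions (model L P s) phi]|%:R =
    \sum_v (v \in solutions (model L P s) phi)%:R :> R.
  rewrite -sum1_card natr_sum big_mkcond/=; apply: eq_bigr => v _.
  by case: (v \in solutions (model L P s) phi).
under [X in _ - X]eq_bigr do rewrite indicE.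
apply: dist_card_le => v; rewrite !inE negb_or negbK negb_exists.
move=> /andP[uv /forallP v0].
have E := model_sat s_free phir uv v0.
by apply/idP/idP; rewrite !inE => /E.
Qed.

End approximation.

(** The squared deviations and the indicators of the null sets [N z] are added into one function of
    mean below [eps ^+ 2]. Where its value is below [eps ^+ 2], no indicator can be 1, as
    [eps <= 1], and each deviation is at most [eps]. *)
Lemma exists_sample (R : realType) (C : finType) (L : borel_mapping R C)
    (K : finType) (p : K -> nat) (phi : forall k, qf_formula C (p k))
    (M P : nat) (eps : R) :
  atomless L ->
  (forall X : set (bm_dom L), measurable X -> X `<=` cyclic_elements L ->
     bm_prob L (mp_fun L @` X) = bm_prob L X) ->
  0 < eps <= 1 ->
  (\sum_k (2 * (p k + p k) ^ 2)%:R) / M.+1%:R < eps ^+ 2 ->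
  exists s : M.+1.-tuple (bm_dom L),
    (forall (i j : 'I_M.+1) b, i != j ->
       tnth s i <> iter b (mp_fun L) (tnth s j)) /\
    forall k, `|frequency R (@rotation R C L M P) (solutions L (phi k)) s -
                borel_density (phi k) L| <= eps.
Proof.
move=> L0 Linv /andP[e0 e1] Meps.
have mf : measurable_fun setT (mp_fun L) by exact: bm_fun_measurable.
pose N (z : 'I_M.+1 * 'I_M.+1) := if z.1 == z.2 then set0 else
  \bigcup_b [set s : M.+1.-tuple (bm_dom L) |
     tnth s z.1 = iter b (mp_fun L) (tnth s z.2)].
have mNb (i j : 'I_M.+1) b : measurable [set s : M.+1.-tuple (bm_dom L) |
    tnth s i = iter b (mp_fun L) (tnth s j)].
  apply: (measurable_eq_fun (bm_standard L)); first exact: measurable_tnth.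
  apply: (@measurableT_comp _ _ _ _ _ _ (iter b (mp_fun L))).
    exact: measurable_fun_iter.
  exact: measurable_tnth.
have mN z : measurable (N z).
  by rewrite /N; case: ifP => // _; apply: bigcupT_measurable => b.
pose mu := power_prob (bm_prob L) M.+1.
have N0 z : mu (N z) = 0%E.
  rewrite /N; case: eqVneq => [|z12]; first by rewrite measure0.
  apply/negligibleP; first by apply: bigcupT_measurable => b.
  apply: negligible_bigcup => b; apply/negligibleP => //.
  apply: (power_prob_graph0 (bm_standard L)) => //.
  exact: measurable_fun_iter.
have mS k : measurable (solutions L (phi k)).
  apply: (measurable_solutions _ (bm_standard L)) => //.
  exact: bm_color_measurable.
have rP e : measure_preserving (bm_prob L) (@rotation R C L M P e).
  exact: rotate_preserving.
have /choice[e eP] : forall k, exists e, has_mean mu (fun s =>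
    (frequency R (@rotation R C L M P) (solutions L (phi k)) s -
     borel_density (phi k) L) ^+ 2) e /\ e <= (2 * (p k + p k) ^ 2)%:R / M.+1%:R.
  move=> k; have [|e me le] := second_moment_frequency (M := M.+1) rP (mS k) (ltn0Sn M).
    by rewrite card_prod !card_ord.
  by exists e; split => //; rewrite /borel_density power_probE.
have [|s] := has_mean_exists_lt (P := mu) (r := eps ^+ 2) (has_meanD
  (has_mean_sum (fun k => (eP k).1))
  (has_mean_sum (fun z => has_mean_indic mu (mN z)))).
  rewrite [X in _ + X]big1 ?addr0; last by move=> z _; rewrite N0.
  apply: le_lt_trans Meps; rewrite mulr_suml; apply: ler_sum => k _.
  exact: (eP k).2.
rewrite /= => sE; exists s.
have ge1 k : 0 <= (frequency R (@rotation R C L M P) (solutions L (phi k)) s -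
     borel_density (phi k) L) ^+ 2 by rewrite sqr_ge0.
have ge2 z : 0 <= \1_(N z) s :> R by rewrite indicE ler0n.
split=> [i j b ij sij|k].
  have : 1 < eps ^+ 2.
    apply: le_lt_trans sE; apply: ler_wpDl; first exact: sumr_ge0.
    rewrite (bigD1 (i, j))//= ler_wpDr ?sumr_ge0//.
    rewrite indicE mem_set// /N /= (negbTE ij); by exists b.
  by rewrite ltNge expr_le1 ?(ltW e0)// e1.
rewrite -(@ler_pXn2r _ 2)// ?nnegrE ?normr_ge0 ?(ltW e0)// real_normK ?num_real//.
apply: ltW; apply: le_lt_trans sE; apply: ler_wpDr; first exact: sumr_ge0.
by rewrite (bigD1 k)//= ler_wpDr ?sumr_ge0.
Qed.

Lemma exists_finite_approximation (R : realType) (C : finType)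
    (L : borel_mapping R C) (K : finType) (p : K -> nat)
    (phi : forall k, qf_formula C (p k)) (eps : R) :
  atomless L ->
  (forall X : set (bm_dom L), measurable X -> X `<=` cyclic_elements L ->
     bm_prob L (mp_fun L @` X) = bm_prob L X) ->
  0 < eps <= 1 ->
  exists F : finite_mapping C, forall k,
    `|finite_density R (phi k) F - borel_density (phi k) L| <= eps + eps.
Proof.
move=> L0 Linv e01; have /andP[e0 e1] := e01.
pose r := \max_k formula_depth (phi k).
(* The factorial makes every positive [b <= r] a divisor; taking that of [r.+1] also gives
   [r < P.+1]. *)
have [P PE] : exists P, P.+1 = (r.+1)`!%N.
  by exists (r.+1)`!.-1%N; rewrite prednK// fact_gt0.
have rP : (r < P.+1)%N by rewrite PE fact_geq.
have dvdP b : (0 < b <= r)%N -> (b %| P.+1)%N.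
  by move=> /andP[b0 br]; rewrite PE dvdn_fact// b0 leqW.
(* [c] adds the constants of the sampling error and of the model error over all [k], so that one [M]
   controls both. *)
pose c : R := \sum_k (2 * (p k + p k) ^ 2)%:R + \sum_k (p k + p k ^ 2)%:R.
pose M := Num.truncn (c / eps ^+ 2).
have cM : c < eps ^+ 2 * M.+1%:R.
  by rewrite mulrC -ltr_pdivrMr ?exprn_gt0// truncnS_gt.
have [|s [s_free sE]] := @exists_sample R C L K p phi M P eps L0 Linv e01.
  rewrite ltr_pdivrMr ?ltr0n//; apply: le_lt_trans cM.
  by rewrite ler_wpDr// sumr_ge0.
exists (finite_model P s) => k.
apply: le_trans (ler_distD _ _ _) (lerD _ (sE k)).
apply: le_trans (dist_density_frequency rP dvdP s_free _) _.
  exact: (leq_bigmax k).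
rewrite ler_pdivrMr ?ltr0n//.
apply: (@le_trans _ _ (eps ^+ 2 * M.+1%:R)); last first.
  by rewrite ler_pM2r ?ltr0n// expr2 ler_piMr// ltW.
apply: ltW; apply: le_lt_trans cM; rewrite /c (bigD1 k)//= [X in _ + X](bigD1 k)//=.
by rewrite ler_wpDl ?ler_wpDr ?addr_ge0 ?sumr_ge0.
Qed.

Theorem theorem4 (R : realType) (C : finType) (L : borel_mapping R C) :
  atomless L ->
  (forall X : set (bm_dom L), measurable X -> X `<=` cyclic_elements L ->
     bm_prob L (mp_fun L @` X) = bm_prob L X) ->
  exists F : nat -> finite_mapping C, QF_convergent R F /\ QF_limit F L.
Proof.
move=> L0 Linv.
(* Diagonal choice: [F n] handles the formulas numbered below [n] in fewer than [n] variables, so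
   each fixed formula is handled from some rank on, with an error tending to 0. *)
have /choice[F FE] : forall n : nat, exists F : finite_mapping C,
    forall k : 'I_n * 'I_n,
      `|finite_density R (formula_enum C k.1 k.2) F -
        borel_density (formula_enum C k.1 k.2) L| <= n.+1%:R^-1 + n.+1%:R^-1.
  move=> n; apply: (@exists_finite_approximation R C L _
    (fun k : 'I_n * 'I_n => k.1 : nat)
    (fun k => formula_enum C k.1 k.2)) => //.
  by rewrite invr_gt0 ltr0n/= invf_le1 ?ltr0n// ler1n.
have FL : QF_limit F L.
  move=> p phi; have [k <-] := formula_enumP phi.
  apply/cvgrPdist_le => e e0; have e20 : 0 < e / 2 by rewrite divr_gt0.
  near=> n.
  have pn : (p < n)%N by near: n; exact: nbhs_infty_gt.
  have kn : (k < n)%N by near: n; exact: nbhs_infty_gt.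
  rewrite distrC; apply: le_trans (FE n (Ordinal pn, Ordinal kn)) _.
  have ne : n.+1%:R^-1 < e / 2.
    by near: n; exact: (near_infty_natSinv_lt (PosNum e20)).
  by rewrite [leRHS]splitr lerD// ltW.
by exists F; split => // p phi; apply: cvgP; exact: FL.
Unshelve. all: by end_near.
Qed.
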